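(* If $n=2\nu$ is even, then $M\in\mathbb{R}^{n\times n}$ is an element of $V_n$ if and only if $$M=\mathcal{X}_n\begin{pmatrix}Y&1_\nu a^T\\ b1_\nu^T&\mathcal{O}_\nu\end{pmatrix}\mathcal{X}_n$$ for some $Y\in V_\nu$ and $a,b\in\mathbb{R}^\nu$. If $n=2\nu+1$ is odd, then $M\in\mathbb{R}^{n\times n}$ is an element of $V_n$ if and only if $$M=\mathcal{X}_n\begin{pmatrix}\sqrt2\,(v1_\nu^T+1_\nu y^T)-\frac{2\sqrt2}{2\nu-1}\,(1_\nu^T(v+y))\,\mathcal{E}_\nu&v&\sqrt2\,1_\nu z^T\\ y^T&\frac{\sqrt2}{2\nu-1}\,1_\nu^T(v+y)&z^T\\ \sqrt2\,x1_\nu^T&x&\mathcal{O}_\nu\end{pmatrix}\mathcal{X}_n$$ with arbitrary $v,x,y,z\in\mathbb{R}^\nu$.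
   Context: $V_n$ is the space of matrices $M\in\mathbb{R}^{n\times n}$ such that $M_{i,j}+M_{k,l}=M_{i,l}+M_{k,j}$ for all $i,j,k,l\in\{1,\dots,n\}$ and $\sum_{i,j=1}^nM_{i,j}=0$. $1_\nu$ and $0_\nu$ are the all-ones and null column vectors in $\mathbb{R}^\nu$; $\mathcal{E}_\nu$ is the $\nu\times\nu$ matrix with all entries $1$; $\mathcal{O}_\nu$ is the $\nu\times\nu$ null matrix; $\mathcal{I}_\nu$ is the $\nu\times\nu$ unit matrix; $\mathcal{J}_\nu=(\delta_{i,\nu+1-j})_{i,j=1}^\nu$ (ones on the antidiagonal, zeros elsewhere); and $$\mathcal{X}_n=\frac1{\sqrt2}\begin{pmatrix}\mathcal{I}_\nu&\mathcal{J}_\nu\\ \mathcal{J}_\nu&-\mathcal{I}_\nu\end{pmatrix}\ (n=2\nu),\qquad \mathcal{X}_n=\begin{pmatrix}\frac1{\sqrt2}\mathcal{I}_\nu&0_\nu&\frac1{\sqrt2}\mathcal{J}_\nu\\ 0_\nu^T&1&0_\nu^T\\ \frac1{\sqrt2}\mathcal{J}_\nu&0_\nu&-\frac1{\sqrt2}\mathcal{I}_\nu\end{pmatrix}\ (n=2\nu+1).$$ *)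

(* Defs.v *)
From mathcomp Require Import all_boot all_order all_algebra.
From mathcomp Require Import classical_sets reals.

Set Implicit Arguments.
Unset Strict Implicit.
Unset Printing Implicit Defensive.

Import Order.TTheory GRing.Theory Num.Theory.
Local Open Scope ring_scope.

Section Definitions.
Variable R : realType.

Definition V (n : nat) : set 'M[R]_n :=
  [set M : 'M[R]_n |
     (forall i j k l : 'I_n, M i j + M k l = M i l + M k j) /\
     \sum_(i < n) \sum_(j < n) M i j = 0]%classic.

Definition ones (nu : nat) : 'cV[R]_nu := const_mx 1.

Definition all_ones_mx (nu : nat) : 'M[R]_nu := const_mx 1.

(* With indices 1..nu, [rev_ord j] is nu + 1 - j. *)
Definition exchange_mx (nu : nat) : 'M[R]_nu :=
  \matrix_(i < nu, j < nu) (i == rev_ord j)%:R.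

Definition block3_mx (m1 m2 m3 n1 n2 n3 : nat)
    (A11 : 'M[R]_(m1, n1)) (A12 : 'M[R]_(m1, n2)) (A13 : 'M[R]_(m1, n3))
    (A21 : 'M[R]_(m2, n1)) (A22 : 'M[R]_(m2, n2)) (A23 : 'M[R]_(m2, n3))
    (A31 : 'M[R]_(m3, n1)) (A32 : 'M[R]_(m3, n2)) (A33 : 'M[R]_(m3, n3)) :
    'M[R]_(m1 + (m2 + m3), n1 + (n2 + n3)) :=
  block_mx A11               (row_mx A12 A13)
           (col_mx A21 A31)  (block_mx A22 A23 A32 A33).

(* The size n = 2 nu is written nu + nu, and n = 2 nu + 1 is written
   nu + (1 + nu), so that block decompositions need no casts. *)
Definition X_even (nu : nat) : 'M[R]_(nu + nu) :=
  (Num.sqrt 2)^-1 *: block_mx 1%:M             (exchange_mx nu)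
                              (exchange_mx nu) (- 1%:M).

Definition X_odd (nu : nat) : 'M[R]_(nu + (1 + nu)) :=
  let c : R := (Num.sqrt 2)^-1 in
  block3_mx (c *: 1%:M)            0     (c *: exchange_mx nu)
            0                      1%:M  0
            (c *: exchange_mx nu)  0     (- c *: 1%:M).

End Definitions.

Arguments V {R} n.
Arguments ones {R} nu.
Arguments all_ones_mx {R} nu.
Arguments exchange_mx {R} nu.
Arguments X_even {R} nu.
Arguments X_odd {R} nu.

(* Main.v *)
(** V_n consists of the matrices p 1^T + 1 q^T with 1^T (p + q) = 0. Since X_n
    is a symmetric involution, conjugating by it replaces the vector 1 by X_n 1,
    which is sqrt 2 (1, 0) for n = 2 nu and (sqrt 2 1, 1, 0) for n = 2 nu + 1;
    expanding p (X_n 1)^T + (X_n 1) q^T blockwise gives the two forms. *)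

Require Import Defs.
From mathcomp Require Import all_boot all_order all_algebra.
From mathcomp Require Import classical_sets reals.
From mathcomp Require Import ring.

Set Implicit Arguments.
Unset Strict Implicit.
Unset Printing Implicit Defensive.

Import Order.TTheory GRing.Theory Num.Theory.
Local Open Scope ring_scope.

Section SeparableMatrices.
Variable R : realType.
Implicit Types n nu : nat.

(** * Separable form of the elements of V_n, and conjugation *)

(** The exchange identity against index 0 recovers every entry from row 0 and column 0, and the
    entries of p 1^T + 1 q^T sum to n 1^T (p + q). The size n = 0 is split off: it has no index
    0. *)
Lemma mem_V_separable n (M : 'M[R]_n) :
  V n M <-> exists p q : 'cV[R]_n,
    M = p *m (ones n)^T + ones n *m q^T /\ (ones n)^T *m (p + q) = 0.
Proof.
case: n M => [|n] M.
  split=> [_|_]; last by split=> [[]|] //; rewrite big_ord0.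
  by exists 0, 0; split; [rewrite !flatmx0 | rewrite addr0 mulmx0].
have sepE (p q : 'cV[R]_n.+1) i j :
    (p *m (ones n.+1)^T + ones n.+1 *m q^T) i j = p i 0 + q j 0.
  by rewrite !mxE !big_ord1 !mxE mulr1 mul1r.
have sumE (p q : 'cV[R]_n.+1) :
    \sum_i \sum_j (p *m (ones n.+1)^T + ones n.+1 *m q^T) i j
    = n.+1%:R * ((ones n.+1)^T *m (p + q)) 0 0.
  under eq_bigr => i _ do under eq_bigr => j _ do rewrite sepE.
  under eq_bigr => i _ do rewrite big_split /= sumr_const card_ord.
  rewrite big_split /= sumr_const card_ord sumrMnl -mulrnDl mulr_natl.
  congr (_ *+ _); rewrite mxE -big_split.
  by apply: eq_bigr => i _; rewrite !mxE mul1r.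
split=> [[Mflat Msum] | [p [q [-> pq0]]]].
  (* Column 0 and row 0 of [M]; the corner is subtracted once because both contain it. *)
  pose p := \col_i M i 0; pose q := \col_j (M 0 j - M 0 0).
  have ME : M = p *m (ones n.+1)^T + ones n.+1 *m q^T.
    by apply/matrixP=> i j; rewrite sepE !mxE addrA -Mflat addrK.
  exists p, q; split=> //; apply/matrixP=> i j; rewrite !ord1 [RHS]mxE.
  by move/eqP: Msum; rewrite ME sumE mulf_eq0 pnatr_eq0 => /eqP.
split=> [i j k l|]; first by rewrite !sepE; ring.
by rewrite sumE pq0 mxE mulr0.
Qed.

(** Serves both parities. The substitution p -> X p, q -> X q is its own inverse, so it gives the
    witnesses in both directions; by symmetry of X, 1^T (X p + X q) = (X 1)^T (p + q). *)
Lemma mem_V_conj n (X M : 'M[R]_n) (u : 'cV[R]_n) :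
    X^T = X -> X *m X = 1%:M -> X *m ones n = u ->
  V n M <-> exists p q : 'cV[R]_n,
    M = X *m (p *m u^T + u *m q^T) *m X /\ u^T *m (p + q) = 0.
Proof.
move=> Xsym Xinv <-; have conjE (p q : 'cV[R]_n) :
    X *m (p *m (X *m ones n)^T + (X *m ones n) *m q^T) *m X
    = (X *m p) *m (ones n)^T + ones n *m (X *m q)^T.
  rewrite !trmx_mul Xsym mulmxDr mulmxDl !mulmxA Xinv mul1mx.
  by rewrite -!(mulmxA _ X X) Xinv mulmx1.
rewrite mem_V_separable; split=> -[p [q [-> pq0]]].
  exists (X *m p), (X *m q); rewrite conjE !mulmxA Xinv !mul1mx; split=> //.
  by rewrite trmx_mul Xsym -mulmxDr mulmxA -(mulmxA _ X X) Xinv mulmx1.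
exists (X *m p), (X *m q); rewrite conjE -mulmxDr; split=> //.
by rewrite mulmxA -[X in _ *m X *m _]Xsym -trmx_mul.
Qed.

(** * The square root of 2 and the exchange matrix *)

Lemma sqrt2_neq0 : Num.sqrt 2 != 0 :> R.
Proof. by rewrite gt_eqF // sqrtr_gt0 ltr0n. Qed.

Lemma sqr_sqrt2 : Num.sqrt 2 * Num.sqrt 2 = 2 :> R.
Proof. by rewrite -expr2 sqr_sqrtr ?ler0n. Qed.

Lemma inv_sqrt2_sqrD : (Num.sqrt 2)^-1 * (Num.sqrt 2)^-1
    + (Num.sqrt 2)^-1 * (Num.sqrt 2)^-1 = 1 :> R.
Proof. by rewrite -invfM sqr_sqrt2; field. Qed.

Lemma inv_sqrt2D : (Num.sqrt 2)^-1 + (Num.sqrt 2)^-1 = Num.sqrt 2 :> R.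
Proof.
by apply: (mulIf sqrt2_neq0); rewrite sqr_sqrt2 mulrDl mulVf ?sqrt2_neq0.
Qed.

Lemma tr_exchange_mx nu : (exchange_mx nu)^T = exchange_mx nu :> 'M[R]_nu.
Proof. by apply/matrixP=> i j; rewrite !mxE eq_sym (canF_eq rev_ordK). Qed.

Lemma mul_exchange_mx nu m (A : 'M[R]_(nu, m)) :
  exchange_mx nu *m A = \matrix_(i, j) A (rev_ord i) j.
Proof.
apply/matrixP=> i j; rewrite !mxE (bigD1 (rev_ord i)) //=.
rewrite mxE rev_ordK eqxx mul1r.
rewrite big1 ?addr0 // => k ki; rewrite mxE -(canF_eq rev_ordK) eq_sym.
by rewrite (negPf ki) mul0r.
Qed.

Lemma exchange_mxK nu : exchange_mx nu *m exchange_mx nu = 1%:M :> 'M[R]_nu.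
Proof.
by apply/matrixP=> i j; rewrite mul_exchange_mx !mxE (can_eq rev_ordK).
Qed.

Lemma exchange_mx_ones nu : exchange_mx nu *m ones nu = ones nu :> 'cV[R]_nu.
Proof. by apply/matrixP=> i j; rewrite mul_exchange_mx !mxE. Qed.

(** * The matrices X_n: symmetry, involution, image of the all-ones vector *)

Lemma tr_X_even nu : (X_even nu)^T = X_even nu :> 'M[R]_(nu + nu).
Proof.
by rewrite /X_even linearZ /= tr_block_mx linearN /= trmx1 tr_exchange_mx.
Qed.

Lemma X_evenK nu : X_even nu *m X_even nu = 1%:M :> 'M[R]_(nu + nu).
Proof.
rewrite /X_even -scalemxAl -scalemxAr scalerA mulmx_block.
rewrite !(mulmxN, mulNmx, mul1mx, mulmx1) exchange_mxK subrr opprK.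
rewrite scale_block_mx scaler0 scalerDr -scalerDl inv_sqrt2_sqrD scale1r.
by rewrite -scalar_mx_block.
Qed.

Lemma X_even_ones nu :
  X_even nu *m ones (nu + nu) = Num.sqrt 2 *: col_mx (ones nu) 0 :> 'cV[R]__.
Proof.
rewrite /X_even -scalemxAl.
rewrite -[ones (nu + nu)]/(const_mx 1) -col_mx_const -/(ones nu).
rewrite mul_block_col.
rewrite mulNmx !mul1mx exchange_mx_ones subrr.
by rewrite !scale_col_mx !scaler0 scalerDr -scalerDl inv_sqrt2D.
Qed.

Lemma tr_X_odd nu : (X_odd nu)^T = X_odd nu :> 'M[R]_(nu + (1 + nu)).
Proof.
rewrite /X_odd /block3_mx !tr_block_mx tr_row_mx tr_col_mx !trmx0 trmx1.
by rewrite !linearZ /= trmx1 tr_exchange_mx.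
Qed.

Lemma X_oddK nu : X_odd nu *m X_odd nu = 1%:M :> 'M[R]_(nu + (1 + nu)).
Proof.
rewrite /X_odd /block3_mx !mulmx_block mul_row_col mul_mx_row mul_row_block.
rewrite mul_block_col mul_col_mx mul_col_row.
rewrite !(mul0mx, mulmx0, addr0, add0r, mul1mx, mulmx1).
rewrite -!(scalemxAl, scalemxAr) !(mul1mx, mulmx1) !scalerA exchange_mxK.
rewrite add_block_mx !add_row_mx !add_col_mx -!scalerDl !(mulrN, mulNr, opprK).
rewrite !subrr inv_sqrt2_sqrD !scale1r !scale0r !addr0 !add0r.
by rewrite row_mx0 col_mx0 -!scalar_mx_block.
Qed.

Lemma X_odd_ones nu :
  X_odd nu *m ones (nu + (1 + nu))
  = col_mx (Num.sqrt 2 *: ones nu) (col_mx 1%:M 0) :> 'cV[R]__.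
Proof.
rewrite -[ones (nu + (1 + nu))]/(const_mx 1) -!col_mx_const -/(ones nu).
rewrite /X_odd /block3_mx mul_block_col mul_row_col mul_col_mx mul_block_col.
rewrite !(mul0mx, mulmx0, addr0, add0r, mul1mx, mulmx1).
rewrite -!scalemxAl exchange_mx_ones mul1mx.
rewrite add_col_mx -scalerDl inv_sqrt2D add0r scaleNr subrr.
by congr (col_mx _ (col_mx _ _)); apply/matrixP=> i j; rewrite !mxE !ord1.
Qed.

(** * Even order *)

Lemma block_even nu (p1 q1 p2 q2 : 'cV[R]_nu) :
  let u := Num.sqrt 2 *: col_mx (ones nu) 0 in
  col_mx p1 p2 *m u^T + u *m (col_mx q1 q2)^T
  = block_mx ((Num.sqrt 2 *: p1) *m (ones nu)^T
              + ones nu *m (Num.sqrt 2 *: q1)^T)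
             (ones nu *m (Num.sqrt 2 *: q2)^T)
             ((Num.sqrt 2 *: p2) *m (ones nu)^T) 0.
Proof.
move=> u; rewrite /u !linearZ /= -!(scalemxAl, scalemxAr) -scalerDr.
rewrite !tr_col_mx !mul_col_row add_block_mx scale_block_mx.
by rewrite !(trmx0, mul0mx, mulmx0, addr0, add0r, scaler0) scalerDr.
Qed.

Lemma mem_V_even nu (M : 'M[R]_(nu + nu)) :
  V (nu + nu) M <->
  exists (Y : 'M[R]_nu) (a b : 'cV[R]_nu),
    V nu Y /\
    M = X_even nu
        *m block_mx Y (ones nu *m a^T) (b *m (ones nu)^T) 0 *m X_even nu.
Proof.
(* The constraint sees only the upper halves, where it is the zero-sum condition on [Y]; hence [a]
   and [b] are free. *)
have dotE (p1 q1 p2 q2 : 'cV[R]_nu) :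
    (Num.sqrt 2 *: col_mx (ones nu) 0)^T *m (col_mx p1 p2 + col_mx q1 q2)
    = (ones nu)^T *m (Num.sqrt 2 *: p1 + Num.sqrt 2 *: q1).
  rewrite linearZ /= tr_col_mx trmx0 add_col_mx -scalemxAl mul_row_col mul0mx.
  by rewrite addr0 -scalerDr scalemxAr.
rewrite (mem_V_conj M (tr_X_even nu) (X_evenK nu) (X_even_ones nu)).
split=> [[p [q]] | [Y [a [b [/mem_V_separable[p [q [-> pq0]]] ->]]]]].
  rewrite -(vsubmxK p) -(vsubmxK q) block_even dotE => -[-> pq0].
  (* The blocks of [block_even] supply [Y], a = sqrt 2 q2 and b = sqrt 2 p2. *)
  do 3!eexists; split; last by [].
  by apply/mem_V_separable; do 2!eexists.
(* Cancels the factor sqrt 2 that X_n 1 brings into each block. *)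
pose h (w : 'cV[R]_nu) := (Num.sqrt 2)^-1 *: w.
have hK w : Num.sqrt 2 *: h w = w by rewrite scalerA divff ?scale1r ?sqrt2_neq0.
exists (col_mx (h p) (h b)), (col_mx (h q) (h a)).
by rewrite block_even dotE !hK.
Qed.

(** * Odd order *)

Lemma block_odd nu (p1 q1 p2 q2 : 'cV[R]_nu) (p0 q0 : 'cV[R]_1) :
  let u := col_mx (Num.sqrt 2 *: ones nu) (col_mx 1%:M 0) in
  col_mx p1 (col_mx p0 p2) *m u^T + u *m (col_mx q1 (col_mx q0 q2))^T
  = block3_mx (Num.sqrt 2 *: (p1 *m (ones nu)^T + ones nu *m q1^T))
              (p1 + Num.sqrt 2 *: (ones nu *m q0^T))
              (Num.sqrt 2 *: (ones nu *m q2^T))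
              (Num.sqrt 2 *: (p0 *m (ones nu)^T) + q1^T)
              (p0 + q0^T)
              q2^T
              (Num.sqrt 2 *: (p2 *m (ones nu)^T))
              p2
              0.
Proof.
move=> u; rewrite /u /block3_mx !tr_col_mx !mul_col_row add_block_mx.
rewrite !mul_mx_row !mul_col_mx !add_row_mx !add_col_mx.
rewrite !linearZ /= trmx1 trmx0 !(mul0mx, mulmx0, addr0, add0r, mul1mx, mulmx1).
rewrite -!(scalemxAl, scalemxAr) -scalerDr.
by rewrite !add_row_mx !(addr0, add0r).
Qed.

(* With sigma = 1^T (p1 + q1) and t = p0 + q0, the right-hand condition is
   (X_n 1)^T (p + q) = 0: it holds iff the central entry prescribed by the
   normal form is the actual one, p0 + q0. *)
Lemma odd_center_eq (nu : nat) (sigma s t : R) :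
  s = sigma + Num.sqrt 2 * nu%:R * t ->
  (Num.sqrt 2 / (2 * nu%:R - 1) * s == t) = (Num.sqrt 2 * sigma + t == 0).
Proof.
(* By parity 2 nu is never 1; this includes nu = 0, where the denominator is -1. *)
have d0 : 2 * nu%:R - 1 != 0 :> R.
  rewrite subr_eq0 -natrM pnatr_eq1.
  by apply/eqP=> /(congr1 odd); rewrite mul2n odd_double.
(* After clearing the denominator, sqrt 2 s - (2 nu - 1) t = sqrt 2 sigma + t, since the terms 2 nu
   t cancel. *)
move=> ->; rewrite mulrAC -(inj_eq (mulIf d0)) divfK // -subr_eq0.
by congr (_ == 0); rewrite mulrDr !mulrA sqr_sqrt2; ring.
Qed.

Lemma mem_V_odd nu (M : 'M[R]_(nu + (1 + nu))) :
  V (nu + (1 + nu)) M <->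
  exists v x y z : 'cV[R]_nu,
    let s : R := ((ones nu)^T *m (v + y)) 0 0 in
    M = X_odd nu
        *m block3_mx
             (Num.sqrt 2 *: (v *m (ones nu)^T + ones nu *m y^T)
              - (2 * Num.sqrt 2 / (2 * nu%:R - 1) * s) *: all_ones_mx nu)
             v
             (Num.sqrt 2 *: (ones nu *m z^T))
             y^T
             (Num.sqrt 2 / (2 * nu%:R - 1) * s)%:M
             z^T
             (Num.sqrt 2 *: (x *m (ones nu)^T))
             x
             0
        *m X_odd nu.
Proof.
(* [v] and [y] are read off the middle column and row. Replacing p1 by v - sqrt 2 b 1 and q1 by y -
   sqrt 2 a 1 in the upper left block produces the correction -2 (a + b) times the all-ones
   matrix. *)
have formE (p1 q1 p2 q2 : 'cV[R]_nu) (a b : R) :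
    let u := col_mx (Num.sqrt 2 *: ones nu) (col_mx 1%:M 0) in
    let v := p1 + (Num.sqrt 2 * b) *: ones nu in
    let y := q1 + (Num.sqrt 2 * a) *: ones nu in
    col_mx p1 (col_mx a%:M p2) *m u^T + u *m (col_mx q1 (col_mx b%:M q2))^T
    = block3_mx
        (Num.sqrt 2 *: (v *m (ones nu)^T + ones nu *m y^T)
         - (2 * (a + b)) *: all_ones_mx nu)
        v (Num.sqrt 2 *: (ones nu *m q2^T)) y^T (a + b)%:M q2^T
        (Num.sqrt 2 *: (p2 *m (ones nu)^T)) p2 0.
  move=> u v y; rewrite /u /v /y block_odd; congr block3_mx.
  - apply/matrixP=> i j; rewrite !(mxE, big_ord1) !mulr1 !mul1r.
    by ring: sqr_sqrt2.
  - by rewrite tr_scalar_mx mul_mx_scalar scalerA.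
  - by rewrite mul_scalar_mx scalerA linearD linearZ /= addrC.
  - by rewrite tr_scalar_mx -raddfD.
have dotE (p1 q1 p2 q2 : 'cV[R]_nu) (a b : R) :
    (col_mx (Num.sqrt 2 *: ones nu) (col_mx 1%:M 0))^T
      *m (col_mx p1 (col_mx a%:M p2) + col_mx q1 (col_mx b%:M q2))
    = (Num.sqrt 2 * ((ones nu)^T *m (p1 + q1)) 0 0 + (a + b))%:M.
  rewrite !tr_col_mx !add_col_mx !mul_row_col trmx0 trmx1 mul0mx addr0 mul1mx.
  rewrite linearZ /= -scalemxAl [X in _ *: X]mx11_scalar scale_scalar_mx.
  by rewrite -!raddfD.
(* The hypothesis of [odd_center_eq] for s = 1^T (v + y) and t = a + b; the factor nu is 1^T 1. *)
have centerE (p1 q1 : 'cV[R]_nu) (a b : R) :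
    ((ones nu)^T *m (p1 + (Num.sqrt 2 * b) *: ones nu
                     + (q1 + (Num.sqrt 2 * a) *: ones nu))) 0 0
    = ((ones nu)^T *m (p1 + q1)) 0 0 + Num.sqrt 2 * nu%:R * (a + b).
  rewrite addrACA -scalerDl mulmxDr mxE -scalemxAr; congr (_ + _).
  rewrite !mxE; under eq_bigr => i _ do rewrite !mxE mul1r.
  by rewrite sumr_const card_ord; ring.
rewrite (mem_V_conj M (tr_X_odd nu) (X_oddK nu) (X_odd_ones nu)).
split=> [[p [q]] | [v [x [y [z ->]]]]].
  rewrite -(vsubmxK p) -(vsubmxK q) -(vsubmxK (dsubmx p)) -(vsubmxK (dsubmx q)).
  rewrite [usubmx (dsubmx p)]mx11_scalar [usubmx (dsubmx q)]mx11_scalar.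
  move: (usubmx p) (usubmx q) (dsubmx (dsubmx p)) (dsubmx (dsubmx q)).
  move: (usubmx _ 0 0) (usubmx _ 0 0) => b a p1 q1 p2 q2.
  rewrite formE dotE => -[-> /matrixP/(_ 0 0)].
  rewrite [LHS]mxE [RHS]mxE eqxx mulr1n => /eqP.
  (* The constraint turns into the prescribed value of the central entry a + b, which also fixes the
     correction in the upper left block. *)
  rewrite -(odd_center_eq (centerE _ _ _ _)) => /eqP sE.
  exists (p1 + (Num.sqrt 2 * b) *: ones nu), p2.
  by exists (q1 + (Num.sqrt 2 * a) *: ones nu), q2; rewrite /= -!(mulrA 2) sE.
set s := _ 0 0; set t := Num.sqrt 2 / (2 * nu%:R - 1) * s.
(* Only the sum of the central entries of p and q is determined: p takes all of [t] and q takes 0.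
   Then p1 is [v] itself, and [y] must be shifted to give [q1]. *)
pose q1 := y - (Num.sqrt 2 * t) *: ones nu.
have vE : v = v + (Num.sqrt 2 * 0) *: ones nu by rewrite mulr0 scale0r addr0.
have yE : y = q1 + (Num.sqrt 2 * t) *: ones nu by rewrite subrK.
exists (col_mx v (col_mx t%:M x)), (col_mx q1 (col_mx 0%:M z)).
rewrite formE dotE -vE -yE addr0 -!(mulrA 2); split=> //.
have /odd_center_eq/esym :
    s = ((ones nu)^T *m (v + q1)) 0 0 + Num.sqrt 2 * nu%:R * t.
  by rewrite -[t in RHS]addr0 -centerE -vE -yE.
by rewrite eqxx => /eqP ->; rewrite raddf0.
Qed.

End SeparableMatrices.

Theorem theorem6 (R : realType) (nu : nat) :
  (forall M : 'M[R]_(nu + nu),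
     V (nu + nu) M <->
     exists (Y : 'M[R]_nu) (a b : 'cV[R]_nu),
       V nu Y /\
       M = X_even nu
           *m block_mx Y                 (ones nu *m a^T)
                       (b *m (ones nu)^T) 0
           *m X_even nu)
  /\
  (forall M : 'M[R]_(nu + (1 + nu)),
     V (nu + (1 + nu)) M <->
     exists v x y z : 'cV[R]_nu,
       let s : R := ((ones nu)^T *m (v + y)) 0 0 in
       M = X_odd nu
           *m block3_mx
                (Num.sqrt 2 *: (v *m (ones nu)^T + ones nu *m y^T)
                 - (2 * Num.sqrt 2 / (2 * nu%:R - 1) * s) *: all_ones_mx nu)
                v
                (Num.sqrt 2 *: (ones nu *m z^T))
                y^T
                (Num.sqrt 2 / (2 * nu%:R - 1) * s)%:M
                z^T
                (Num.sqrt 2 *: (x *m (ones nu)^T))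
                x
                0
           *m X_odd nu).
Proof. by split=> M; [apply: mem_V_even | apply: mem_V_odd]. Qed.
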